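(* Let $a<b$, let $\gamma$ be an admissible path on $[a,b]$ with $\xi:=\log\gamma$ and $\|\dot\xi\|_\infty\le 1/10$ (hence in particular kinetically admissible), and let $m>0$. Then $$\left|\,m\,\mathcal{A}[\gamma]-\frac m2\int_a^b\dot\xi(t)^2\,dt\,\right|\;\le\;\frac{m}{24}\cdot\frac{100}{99}\int_a^b\dot\xi(t)^4\,dt\;\le\;\frac{m}{2376}\int_a^b\dot\xi(t)^2\,dt.$$ Consequently, setting $q:=\xi$, the mass-weighted kinetic action $m\,\mathcal{A}[\gamma]$ agrees with the standard kinetic integral $T[q]=\tfrac12\int_a^b m\,\dot q(t)^2\,dt$ with relative error at most $1/1188$, i.e. $|m\mathcal{A}[\gamma]-T[q]|\le\frac{1}{1188}T[q]$.
   Context: For $a<b$, an admissible path on $[a,b]$ is an absolutely continuous function $\gamma:[a,b]\to(0,\infty)$ (strictly positive at every point) with $\dot\gamma\in L^2([a,b])$. It is kinetically admissible if, with $\xi:=\log\gamma$, $\int_a^b[\cosh(\dot\xi(t))-1]\,dt<\infty$; its kinetic action is then $\mathcal{A}[\gamma]:=\int_a^b[\cosh(\dot\xi(t))-1]\,dt$. $\|\cdot\|_\infty$ is the essential supremum norm on $[a,b]$. *)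

(* Defs.v *)
From HB Require Import structures.
From mathcomp Require Import all_boot all_order all_algebra.
From mathcomp Require Import all_classical all_reals all_analysis.

Set Implicit Arguments.
Unset Strict Implicit.
Unset Printing Implicit Defensive.

Import Order.TTheory GRing.Theory Num.Theory.
Import numFieldNormedType.Exports.

Local Open Scope classical_set_scope.
Local Open Scope ring_scope.

Definition cosh {R : realType} (x : R) : R := (expR x + expR (- x)) / 2.

(* Paths on [a, b] are total functions R -> R whose values outside [a, b] are
   irrelevant.  The a.e. derivative of an absolutely continuous path is its
   pointwise derivative derive1 f, which has the junk value 0 where f is not
   derivable; on [a, b], the values of f outside [a, b] can only affect derive1 f
   at the two endpoints, hence on a null set. *)

Definition absolutely_continuous {R : realType} (a b : R) (f : R -> R) : Prop :=
  forall e : R, 0 < e -> exists2 d : R, 0 < d &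
    forall (n : nat) (x y : 'I_n -> R),
      (forall k, [/\ a <= x k, x k < y k & y k <= b]) ->
      trivIset [set: 'I_n] (fun k => `]x k, y k[%classic) ->
      \sum_(k < n) (y k - x k) < d ->
      \sum_(k < n) `|f (y k) - f (x k)| < e.

(* L^2([a, b]) and the L^oo norm on [a, b] are expressed through the extension
   by zero g \_ `[a, b] of g to the whole line. *)

Definition square_integrable_on {R : realType} (a b : R) (g : R -> R) : Prop :=
  (g \_ `[a, b] : R -> R) \in Lfun (@lebesgue_measure R) 2%:E.

Definition sup_norm_on {R : realType} (a b : R) (g : R -> R) : \bar R :=
  ('N[@lebesgue_measure R]_+oo [EFin \o (g \_ `[a, b])])%E.

Definition admissible {R : realType} (a b : R) (gamma : R -> R) : Prop :=
  [/\ absolutely_continuous a b gamma,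
      (forall t, t \in `[a, b] -> 0 < gamma t) &
      square_integrable_on a b (derive1 gamma)].

Definition log_path {R : realType} (gamma : R -> R) : R -> R :=
  fun t => ln (gamma t).

Definition kinetically_admissible {R : realType} (a b : R) (gamma : R -> R) :
    Prop :=
  admissible a b gamma /\
  (\int[@lebesgue_measure R]_(t in `[a, b])
     (cosh (derive1 (log_path gamma) t) - 1)%:E < +oo)%E.

Definition kinetic_action {R : realType} (a b : R) (gamma : R -> R) : R :=
  \int[@lebesgue_measure R]_(t in `[a, b]) (cosh (derive1 (log_path gamma) t) - 1).

Definition kinetic_integral {R : realType} (m a b : R) (q : R -> R) : R :=
  2^-1 * \int[@lebesgue_measure R]_(t in `[a, b]) (m * derive1 q t ^+ 2).

(* Main.v *)
(* On ]a, b[, gamma is continuous and positive, so xi = ln gamma is derivable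
   exactly where gamma is and xi' = gamma' / gamma everywhere, junk values
   included; hence xi' is measurable, and no a.e. differentiability theorem is
   needed.  The Taylor series of cosh, with remainder dominated by a geometric
   series of ratio x^2, gives
   0 <= cosh x - 1 - x^2/2 <= (x^4/24) / (1 - x^2) <= (x^4/24) * (100/99)
   for |x| <= 1/10; the bounds follow by integrating along xi'. *)
Require Import Defs.
From HB Require Import structures.
From mathcomp Require Import all_boot all_order all_algebra.
From mathcomp Require Import all_classical all_reals all_analysis.
From mathcomp Require Import ess_sup_inf measurable_realfun ring lra.

Set Implicit Arguments.
Unset Strict Implicit.
Unset Printing Implicit Defensive.

Import Order.TTheory GRing.Theory Num.Theory.
Import numFieldNormedType.Exports.

Local Open Scope classical_set_scope.
Local Open Scope ring_scope.

(** The partial sum is the mean of the exponential series at [x] and at [- x], both cut at [n.*2]: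
    odd terms cancel and even terms coincide. The powers are kept as powers of [x ^+ 2] for the
    geometric comparison. *)
Lemma cvg_cosh_series (R : realType) (x : R) :
  (\sum_(0 <= k < n) (x ^+ 2) ^+ k / (k.*2)`!%:R) @[n --> \oo] --> cosh x.
Proof.
have cvgE (y : R) : series (exp_coeff y) n.*2 @[n --> \oo] --> expR y.
  apply: (@cvg_comp _ _ _ double (series (exp_coeff y)) _ \oo).
    apply/cvgnyPge => A; near=> n.
    by rewrite -addnn (leq_trans _ (leq_addr _ _))//; near: n; exact: nbhs_infty_ge.
  exact: is_cvg_series_exp_coeff.
have -> : (fun n => \sum_(0 <= k < n) (x ^+ 2) ^+ k / (k.*2)`!%:R) =
          (fun n => (series (exp_coeff x) n.*2 + series (exp_coeff (- x)) n.*2) / 2).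
  apply/funext => n; elim: n => [|n IHn].
    by rewrite /series/= !big_geq// addr0 mul0r.
  have eE : exp_coeff (- x) n.*2 = exp_coeff x n.*2.
    by rewrite /exp_coeff/= exprNn -signr_odd odd_double mul1r.
  have oE : exp_coeff (- x) n.*2.+1 = - exp_coeff x n.*2.+1.
    by rewrite /exp_coeff/= exprNn -signr_odd/= odd_double mulN1r mulNr.
  rewrite big_nat_recr//= IHn.
  have -> : (x ^+ 2) ^+ n / (n.*2)`!%:R = exp_coeff x n.*2.
    by rewrite /exp_coeff/= -exprM mul2n.
  rewrite doubleS /series/=.
  rewrite !(big_nat_recr n.*2.+1)//= !(big_nat_recr n.*2)//= eE oE.
  lra.
by apply: cvgMr_tmp; exact: cvgD.
Unshelve. all: by end_near. Qed.

(** All terms of the series are nonnegative, so the partial sums dominate the first two terms, and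
    the limit inherits the bound. *)
Lemma cosh_sub1_ge (R : realType) (x : R) : x ^+ 2 / 2 <= cosh x - 1.
Proof.
rewrite lerBrDl; apply: (cvgr_to_ge (@cvg_cosh_series R x)).
near=> n.
have : (2 <= n)%N by near: n; exact: nbhs_infty_ge.
move=> n2; rewrite (@big_cat_nat _ _ _ 2)//= big_nat_recr// big_nat1/=.
rewrite expr0 expr1 divr1 lerDl sumr_ge0// => i _.
by rewrite divr_ge0// exprn_ge0// sqr_ge0.
Unshelve. all: by end_near. Qed.

Lemma cosh_sub1_le (R : realType) (x : R) : x ^+ 2 < 1 ->
  cosh x - 1 - x ^+ 2 / 2 <= x ^+ 4 / 24 / (1 - x ^+ 2).
Proof.
set y := x ^+ 2 => y1; have y0 : 0 <= y by exact: sqr_ge0.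
have -> : x ^+ 4 = y ^+ 2 by rewrite -exprM.
have y1' : 0 < 1 - y by rewrite subr_gt0.
rewrite -addrA -opprD lerBlDr.
apply: (cvgr_to_le (@cvg_cosh_series R x)).
near=> n.
have /subnK <- : (2 <= n)%N by near: n; exact: nbhs_infty_ge.
move: (n - 2)%N => k.
(* The factor [1 - y ^+ k] makes the induction close: divided by [1 - y], it is the finite geometric
   sum, whose increment is exactly [y ^+ k]. *)
suff : \sum_(0 <= i < k + 2) y ^+ i / (i.*2)`!%:R <=
   y ^+ 2 / 24 / (1 - y) * (1 - y ^+ k) + (1 + y / 2).
  move=> /le_trans; apply; rewrite lerD2r ler_piMr//.
    by rewrite !divr_ge0// ?sqr_ge0// ltW.
  by rewrite lerBlDr lerDl exprn_ge0.
elim: k => [|k IHk].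
  by rewrite big_nat_recr// big_nat1 /= expr0 subrr mulr0 add0r expr1 divr1;
     exact: lexx.
rewrite addSn big_nat_recr//=; apply: (le_trans (lerD IHk (lexx _))).
rewrite [leRHS](_ : _ = y ^+ 2 / 24 / (1 - y) * (1 - y ^+ k) + (1 + y / 2)
  + y ^+ (k + 2) / 24); last first.
  by rewrite [y ^+ k.+1]exprS exprD; field; rewrite gt_eqF.
rewrite lerD2l ler_wpM2l ?(exprn_ge0 _ y0)//.
rewrite lef_pV2 ?posrE ?ltr0n ?fact_gt0//.
rewrite (_ : 24 = (4`!)%:R)// ler_nat leq_fact// doubleD leq_addl.
Unshelve. all: by end_near. Qed.

(* Also when gamma is not derivable at t: both sides are then the junk value 0. *)
Lemma derive1_log_path (R : realType) (gamma : R -> R) (t : R) :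
  (\forall s \near t, 0 < gamma s) ->
  derive1 (log_path gamma) t = derive1 gamma t / gamma t.
Proof.
move=> gamma_gt0; have gt0 : 0 < gamma t by exact: nbhs_singleton gamma_gt0.
have [dgamma|ndgamma] := pselect (derivable gamma t 1).
  rewrite /log_path -[fun s => _]/((@ln R) \o gamma) derive1_comp//.
    have Dln := is_derive1_ln gt0.
    by rewrite derive1E derive_val mulrC.
  exact: (@ex_derive _ _ _ _ _ _ _ (is_derive1_ln gt0)).
(* Near [t], where [gamma] is positive, [gamma] is the exponential of [log_path gamma], so
   derivability would pass back to [gamma]. *)
have ndlog : ~ derivable (log_path gamma) t 1.
  move=> dlog; apply: ndgamma.
  apply: (@near_eq_derivable _ _ _ (expR \o log_path gamma)).
    by near do rewrite /= /log_path lnK ?posrE//.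
  by apply/derivable1_diffP/differentiable_comp; exact/derivable1_diffP.
by rewrite !derive1E /derive (dvgP ndlog) (dvgP ndgamma) mul0r.
Unshelve. all: by end_near. Qed.

(** Families of a single interval suffice. Since these are oriented, points to the left and to the
    right of [t] are treated separately. *)
Lemma absolutely_continuous_continuous (R : realType) (a b : R) (f : R -> R) :
  absolutely_continuous a b f -> {in `]a, b[, continuous f}.
Proof.
move=> acf t tab; move: (tab); rewrite in_itv/= => /andP[at_ tb].
apply/cvgrPdist_lt => e e0; have [d d0 fd] := acf _ e0.
have step (x y : R) : a <= x -> x < y -> y <= b -> y - x < d ->
    `|f y - f x| < e.
  move=> ax xy yb yxd.
  have := fd 1%N (fun=> x) (fun=> y).
  rewrite !big_ord1; apply => //.
  by apply/trivIsetP => i j _ _; rewrite !ord1 eqxx.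
near=> s.
have : s \in `]a, b[ by near: s; exact: near_in_itvoo.
rewrite in_itv/= => /andP[as_ sb].
have : `|t - s| < d by near: s; exact: cvgr_dist_lt.
have [st|ts|->] := ltgtP s t; last by rewrite !subrr normr0.
- rewrite gtr0_norm ?subr_gt0// => tsd.
  by apply: step => //; exact: ltW.
- rewrite ltr0_norm ?subr_lt0// opprB distrC => std.
  by apply: step => //; exact: ltW.
Unshelve. all: by end_near. Qed.

Lemma measurable_derive1_log_path (R : realType) (a b : R) (gamma : R -> R) :
  admissible a b gamma -> measurable_fun `[a, b] (derive1 (log_path gamma)).
Proof.
move=> [acg gt0 g2].
(* The flags select the open interval: at the endpoints [gamma] need not be positive on a full
   neighbourhood, so the formula for the logarithmic derivative could fail there. *)
apply: (@measurable_fun_itv_cc _ _ _ false true).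
have cg := absolutely_continuous_continuous acg.
have ab_near t : t \in `]a, b[ -> \forall s \near t, 0 < gamma s.
  move=> tab; near=> s; apply: gt0.
  apply: subset_itv_oo_cc; near: s; exact: near_in_itvoo.
apply: (eq_measurable_fun (fun t => derive1 gamma t * (gamma t)^-1)).
  by move=> t; rewrite inE/= => tab; rewrite derive1_log_path//; exact: ab_near.
apply: measurable_funM.
  (* Membership in L^2 carries the measurability of the zero extension. *)
  have mg : measurable_fun setT ((derive1 gamma : R -> R) \_ `[a, b]).
    by have /sub_Lfun_mfun := g2; rewrite inE.
  apply: (@measurable_funS _ _ _ _ `[a, b]%classic) => //.
    exact: subset_itv_oo_cc.
  by apply/(measurable_restrictT (derive1 gamma : R -> R) (measurable_itv `[a, b])).
apply: open_continuous_measurable_fun => [|t]; first exact: interval_open.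
rewrite inE/= => tab; apply: cvgV; last exact: cg.
by rewrite gt_eqF// gt0//; exact: subset_itv_oo_cc.
Unshelve. all: by end_near. Qed.

(** An essential supremum bounds [derive1 xi] only almost everywhere. Deleting a null set containing
    the exceptional points changes neither integral and leaves a pointwise comparison. *)
Lemma ae_le_Rintegral d (T : measurableType d) (R : realType)
    (mu : {measure set T -> \bar R}) (D : set T) (f1 f2 : T -> R) :
  measurable D -> mu.-integrable D (EFin \o f1) ->
  mu.-integrable D (EFin \o f2) ->
  {ae mu, forall x, D x -> f1 x <= f2 x} ->
  \int[mu]_(x in D) f1 x <= \int[mu]_(x in D) f2 x.
Proof.
move=> mD if1 if2 [N [mN N0 fN]].
rewrite /Rintegral (negligible_integral mN)// [in leRHS](negligible_integral mN)//.
have mDN : measurable (D `\` N) by exact: measurableD.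
apply: le_Rintegral => //.
- by apply: integrableS if1.
- by apply: integrableS if2.
- by move=> x [Dx Nx]; apply: contrapT => f12; apply: Nx; apply: fN => /= /(_ Dx).
Qed.

Lemma ae_bounded_integrable d (T : measurableType d) (R : realType)
    (mu : {measure set T -> \bar R}) (D : set T) (f : T -> R) (M : R) :
  measurable D -> (mu D < +oo)%E -> measurable_fun D f -> 0 <= M ->
  {ae mu, forall x, D x -> `|f x| <= M} ->
  mu.-integrable D (EFin \o f).
Proof.
move=> mD Dfin mf M0 fM; apply/integrableP; split; first exact/measurable_EFinP.
apply: (@le_lt_trans _ _ (M%:E * mu D)%E); last by rewrite lte_mul_pinfty.
apply: integral_le_bound => //; exact: measurableT_comp.
Qed.

Lemma sup_norm_on_le (R : realType) (a b M : R) (g : R -> R) :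
  (sup_norm_on a b g <= M%:E)%E ->
  {ae @lebesgue_measure R, forall t, `[a, b]%classic t -> `|g t| <= M}.
Proof.
(* The L^oo norm unfolds to an essential supremum only when the whole space has positive measure. *)
have muT_gt0 : (0 < @lebesgue_measure R [set: R])%E.
  by rewrite -set_itvNyy lebesgue_measure_itv/= adde_gt0 ?ltry.
rewrite /sup_norm_on unlock ifT; last exact: muT_gt0.
move=> /ess_supP; apply: filterS => t /= + abt.
by rewrite patchE mem_set.
Qed.

Lemma cosh_sub1_le_small (R : realType) (x : R) : `|x| <= 1 / 10 ->
  cosh x - 1 <= x ^+ 2 / 2 + 24^-1 * (100 / 99) * x ^+ 4.
Proof.
move=> xle; have x2 : x ^+ 2 <= 1 / 100.
  by move: xle; rewrite ler_norml => /andP[]; nra.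
have x2lt1 : x ^+ 2 < 1 by lra.
rewrite -lerBlDl (le_trans (cosh_sub1_le x2lt1))//.
have -> : 24^-1 * (100 / 99) * x ^+ 4 = x ^+ 4 / 24 * (100 / 99) by lra.
rewrite ler_wpM2l ?divr_ge0 ?exprn_even_ge0//.
(* From [x ^+ 2 <= 1 / 100] follows [1 - x ^+ 2 >= 99 / 100], whose inverse is the constant
   [100 / 99]. *)
by rewrite -[100 / 99]invf_div lef_pV2 ?posrE; lra.
Qed.

Lemma measurable_cosh (R : realType) : measurable_fun [set: R] (@cosh R).
Proof.
apply: measurable_funM => //; apply: measurable_funD => //.
by apply: measurableT_comp.
Qed.

Lemma cosh_integral_estimates d (T : measurableType d) (R : realType)
    (mu : {measure set T -> \bar R}) (D : set T) (g : T -> R) :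
  measurable D -> (mu D < +oo)%E -> measurable_fun D g ->
  {ae mu, forall x, D x -> `|g x| <= 1 / 10} ->
  [/\ mu.-integrable D (EFin \o (fun x => cosh (g x) - 1)),
      mu.-integrable D (EFin \o (fun x => g x ^+ 2)),
      2^-1 * \int[mu]_(x in D) (g x ^+ 2) <= \int[mu]_(x in D) (cosh (g x) - 1),
      \int[mu]_(x in D) (cosh (g x) - 1) <=
      2^-1 * \int[mu]_(x in D) (g x ^+ 2) +
      24^-1 * (100 / 99) * \int[mu]_(x in D) (g x ^+ 4) &
      \int[mu]_(x in D) (g x ^+ 4) <= 100^-1 * \int[mu]_(x in D) (g x ^+ 2)].
Proof.
move=> mD Dfin mg g_small.
(* Every later almost-everywhere claim thus becomes an inequality about one real number of size at
   most [1 / 10]. *)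
have g_ae (P : T -> Prop) : (forall x, `|g x| <= 1 / 10 -> P x) ->
    {ae mu, forall x, D x -> P x}.
  by move=> gP; apply: filterS g_small => x + Dx => /(_ Dx)/gP.
have sqr_small (x : R) : `|x| <= 1 / 10 -> x ^+ 2 <= 1 / 100.
  by rewrite ler_norml => /andP[]; nra.
have exp4_small (x : R) : `|x| <= 1 / 10 -> x ^+ 4 <= x ^+ 2 / 100.
  by move=> /sqr_small; have := sqr_ge0 x; rewrite (exprM x 2 2); nra.
have ig2 : mu.-integrable D (EFin \o (fun x => g x ^+ 2)).
  (* The bound 1, here and for the next two integrands, is a crude choice: on a set of finite
     measure any constant would do. *)
  apply: (@ae_bounded_integrable _ _ _ _ _ _ 1) => //.
    exact: measurable_funX.
  by apply: g_ae => x /sqr_small; rewrite ger0_norm ?sqr_ge0//; lra.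
have ig4 : mu.-integrable D (EFin \o (fun x => g x ^+ 4)).
  apply: (@ae_bounded_integrable _ _ _ _ _ _ 1) => //.
    exact: measurable_funX.
  apply: g_ae => x gx; have := sqr_small _ gx; have := exp4_small _ gx.
  by rewrite ger0_norm ?exprn_even_ge0//; lra.
have igc : mu.-integrable D (EFin \o (fun x => cosh (g x) - 1)).
  apply: (@ae_bounded_integrable _ _ _ _ _ _ 1) => //.
    apply: measurable_funB => //.
    by apply: measurableT_comp => //; exact: measurable_cosh.
  apply: g_ae => x gx.
  have := cosh_sub1_le_small gx; have := cosh_sub1_ge (g x).
  have := sqr_small _ gx; have := exp4_small _ gx; have := sqr_ge0 (g x).
  by move=> *; rewrite ger0_norm; lra.
have iZ (k : R) (f : T -> R) : mu.-integrable D (EFin \o f) ->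
    mu.-integrable D (EFin \o (fun x => k * f x)).
  by move=> /(integrableZl mD k).
split=> //.
- rewrite -RintegralZl//; apply: ae_le_Rintegral => //; first exact: iZ.
  by apply: g_ae => x _; rewrite mulrC cosh_sub1_ge.
- rewrite -!RintegralZl// -RintegralD//; [|exact: iZ|exact: iZ].
  apply: ae_le_Rintegral => //.
    exact: (integrableD mD (iZ _ _ ig2) (iZ _ _ ig4)).
  by apply: g_ae => x /cosh_sub1_le_small; rewrite [_ / 2]mulrC.
- rewrite -RintegralZl//; apply: ae_le_Rintegral => //; first exact: iZ.
  by apply: g_ae => x /exp4_small; rewrite [_ / 100]mulrC.
Qed.

Theorem theorem6p14 (R : realType) (a b m : R) (gamma : R -> R)
    (xi := log_path gamma) :
  a < b ->
  admissible a b gamma ->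
  (sup_norm_on a b (derive1 xi) <= (1 / 10)%:E)%E ->
  0 < m ->
  [/\ kinetically_admissible a b gamma,
      `|m * kinetic_action a b gamma
        - m / 2 * \int[@lebesgue_measure R]_(t in `[a, b]) (derive1 xi t ^+ 2)|
      <= m / 24 * (100 / 99) * \int[@lebesgue_measure R]_(t in `[a, b]) (derive1 xi t ^+ 4),
      m / 24 * (100 / 99) * \int[@lebesgue_measure R]_(t in `[a, b]) (derive1 xi t ^+ 4)
      <= m / 2376 * \int[@lebesgue_measure R]_(t in `[a, b]) (derive1 xi t ^+ 2) &
      `|m * kinetic_action a b gamma - kinetic_integral m a b xi|
      <= 1 / 1188 * kinetic_integral m a b xi].
Proof.
move=> ab adm sup_le m_gt0.
have Dfin : (@lebesgue_measure R `[a, b]%classic < +oo)%E.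
  by rewrite lebesgue_measure_itv/=; case: ifPn => // _; rewrite -EFinB ltry.
have [igc ig2 lo up le42] := @cosh_integral_estimates _ _ R (@lebesgue_measure R)
  `[a, b]%classic (derive1 xi) (measurable_itv _) Dfin
  (measurable_derive1_log_path adm) (sup_norm_on_le sup_le).
rewrite /kinetic_action /kinetic_integral RintegralZl//.
move: lo up le42; rewrite -/xi.
set I2 := \int[_]_(_ in _) (_ ^+ 2); set I4 := \int[_]_(_ in _) (_ ^+ 4).
set Ic := \int[_]_(_ in _) (_ - 1) => lo up le42.
(* Multiplying the estimates by [m] beforehand leaves goals that are linear in the products
   [m * Ic], [m * I2] and [m * I4], within reach of [lra]. *)
have mIc : 0 <= m * (Ic - 2^-1 * I2) by rewrite mulr_ge0 ?subr_ge0// ltW.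
have mI4 : m * (Ic - 2^-1 * I2) <= m * (24^-1 * (100 / 99) * I4).
  by rewrite ler_pM2l// lerBlDl.
have mI42 : m * I4 <= m * (100^-1 * I2) by rewrite ler_pM2l.
split.
- split=> //; have /integrableP[mc] := igc; apply: le_lt_trans.
  apply: ge0_le_integral => //.
  + by move=> t _; rewrite lee_fin (le_trans _ (cosh_sub1_ge _))// divr_ge0 ?sqr_ge0.
  + exact: measurableT_comp.
  + by move=> t _; exact: lee_abs.
- by rewrite ger0_norm; lra.
(* The constant arises as [24 * 99 = 2376], the factor 100 cancelling against [100^-1] in [mI42]. *)
- by lra.
(* The kinetic integral is now [2^-1 * (m * I2)], so the relative error is twice [1 / 2376]. *)
- by rewrite ger0_norm; lra.
Qed.
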